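(* Let $\beta>0$, $\varepsilon\in(0,1]$, and let $q$ be a prompt with reference probability of success $p_{\mathrm{ref}}(q)=\mathbb{P}_{o\sim\pi_{\mathrm{ref}}(\cdot|q)}(r(q,o)=1)$ satisfying $0<p_{\mathrm{ref}}(q)<1$. Let $p^*(q)\in[0,1]$ be a fixed point of $h_{\varepsilon,p_{\mathrm{ref}}(q)}$. Then $p^*(q)>p_{\mathrm{ref}}(q)$.
   Context: $r$ is a binary reward with values in $\{0,1\}$ and $\pi_{\mathrm{ref}}$ is a reference policy (a conditional distribution on outcomes given the prompt). For $p_{\mathrm{ref}}\in(0,1]$, the map $h_{\varepsilon,p_{\mathrm{ref}}}:[0,1]\to[0,1]$ is $$h_{\varepsilon,p_{\mathrm{ref}}}(p)=\frac{1}{1+\frac{1-p_{\mathrm{ref}}}{p_{\mathrm{ref}}}\exp\!\left(-\frac1\beta\frac{1}{\sqrt{p(1-p)+\varepsilon}}\right)}.$$ *)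

(* Defs.v *)
From HB Require Import structures.
From mathcomp Require Import all_boot all_order all_algebra.
From mathcomp Require Import all_classical all_reals all_analysis.

Set Implicit Arguments.
Unset Strict Implicit.
Unset Printing Implicit Defensive.

Import Order.TTheory GRing.Theory Num.Theory.
Import numFieldNormedType.Exports.

Local Open Scope classical_set_scope.
Local Open Scope ring_scope.

(* A policy is a family of probability measures on the outcomes indexed by
   prompts; no measurability in the prompt is required, so every probability
   kernel is an instance. *)
Definition policy (d : measure_display) (R : realType) (Q : Type)
  (O : measurableType d) : Type := Q -> probability O R.

(* [fine] loses nothing here: a probability is always finite. *)
Definition success_prob (d : measure_display) (R : realType) (Q : Type)
  (O : measurableType d) (pi : policy R Q O) (r : Q -> O -> R) (q : Q) : R :=
  fine (pi q [set o | r q o = 1]).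

(* Total on R; it is meant for 0 < pref <= 1, 0 < eps and 0 <= p <= 1, where
   neither the square root nor the inverses take junk values and the result
   lies in [0, 1]. *)
Definition h (R : realType) (beta eps pref p : R) : R :=
  1 / (1 + (1 - pref) / pref
           * expR (- (1 / beta * (1 / Num.sqrt (p * (1 - p) + eps))))).

(* Main.v *)
Require Import Defs.
From HB Require Import structures.
From mathcomp Require Import all_boot all_order all_algebra.
From mathcomp Require Import all_classical all_reals all_analysis.
From mathcomp Require Import ring.

Import Order.TTheory GRing.Theory Num.Theory.
Import numFieldNormedType.Exports.

Local Open Scope classical_set_scope.
Local Open Scope ring_scope.

(** Every value of [h] on [0, 1] already exceeds the reference probability, so a fixed point, being
    its own image, does too. The exponential factor lies strictly below 1 and shrinks the failure
    odds [(1 - pref) / pref], which raises the success probability; [lt_h] carries this. *)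

(* At exponent 0 the map would return [pref] itself; here the exponent is
   strictly negative because eps > 0 keeps the square root positive. *)
Lemma lt_h (R : realType) (beta eps pref p : R) :
  0 < beta -> 0 < pref < 1 -> 0 < p * (1 - p) + eps ->
  pref < h beta eps pref p.
Proof.
move=> beta_gt0 /andP[pref_gt0 pref_lt1] var_gt0; rewrite /h.
set E := expR _.
have E_gt0 : 0 < E by exact: expR_gt0.
have E_lt1 : E < 1.
  by rewrite expR_lt1 oppr_lt0 !mul1r mulr_gt0 ?invr_gt0 ?sqrtr_gt0.
have odds_gt0 : 0 < (1 - pref) / pref by rewrite divr_gt0 ?subr_gt0.
rewrite ltr_pdivlMr; last by rewrite addr_gt0 // mulr_gt0.
(* Written this way, the left side is the average of 1 and [E] with weights [pref] and [1 - pref],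
   hence below 1 because [E < 1] and [pref < 1]. *)
have -> : pref * (1 + (1 - pref) / pref * E) = pref + (1 - pref) * E.
  by field; rewrite gt_eqF.
by rewrite -ltrBrDl gtr_pMr ?subr_gt0.
Qed.

Theorem theorem3 (R : realType) (d : measure_display) (Q : Type)
  (O : measurableType d) (pi_ref : policy R Q O) (r : Q -> O -> R)
  (r_binary : forall (q : Q) (o : O), r q o = 0 \/ r q o = 1)
  (r_measurable : forall q : Q, measurable_fun [set: O] (r q))
  (beta eps : R) (beta_gt0 : 0 < beta) (eps_gt0 : 0 < eps) (eps_le1 : eps <= 1)
  (q : Q) (pref_gt0 : 0 < success_prob pi_ref r q)
  (pref_lt1 : success_prob pi_ref r q < 1)
  (pstar : R) (pstar_ge0 : 0 <= pstar) (pstar_le1 : pstar <= 1)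
  (pstar_fixed : h beta eps (success_prob pi_ref r q) pstar = pstar) :
  success_prob pi_ref r q < pstar.
Proof.
rewrite -pstar_fixed; apply: lt_h; rewrite ?pref_gt0 //.
(* The Bernoulli variance may vanish at the endpoints 0 and 1; [eps] supplies the strictness. *)
by rewrite ltr_wpDl // mulr_ge0 // subr_ge0.
Qed.
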